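(* Let assumption ( ** ) hold, and suppose that $w(t,x)$ is a polynomially bounded LT-solution of the Cauchy problem $(\mathbb D_{(k)} w)(t,x)=\Delta w(t,x)$, $t>0$, $x\in\mathbb R^n$; $w(0,x)=w_0(x)$, with $w_0(x)\equiv 0$. Then $w(t,x)\equiv 0$.
   Context: Let $k$ be a function on $(0,\infty)$ and define the operator $(\mathbb D_{(k)}u)(t)=\frac{d}{dt}\int_0^t k(t-\tau)u(\tau)\,d\tau - k(t)u(0)$, with Laplace transform $\mathcal K(p)=\int_0^\infty e^{-pt}k(t)\,dt$. Assumption ( ** ): the function $k$ is nonnegative, locally integrable, nonzero on a set of positive measure, and its Laplace transform $\mathcal K(p)$ exists for all $p>0$. A function $w(t,x)$ is a polynomially bounded LT-solution of the Cauchy problem if $|w(t,x)|\le P(|x|)$ for some polynomial $P$ independent of $t$, $w$ is continuous in $t$ on $[0,\infty)$ uniformly with respect to $x\in\mathbb R^n$, $w(0,x)=w_0(x)$, and its Laplace transform in $t$, $\tilde w(p,x)$, is twice continuously differentiable in $x$ for each $p>0$ and satisfies $p\mathcal K(p)\tilde w(p,x)-\mathcal K(p)w_0(x)=\Delta \tilde w(p,x)$, $p>0$, $x\in\mathbb R^n$. *)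

(* Defs.v *)
From HB Require Import structures.
From mathcomp Require Import all_boot all_order all_algebra.
From mathcomp Require Import all_classical all_reals all_analysis.
Set Implicit Arguments. Unset Strict Implicit. Unset Printing Implicit Defensive.
Import Order.TTheory GRing.Theory Num.Theory.
Import numFieldNormedType.Exports.
Local Open Scope classical_set_scope.
Local Open Scope ring_scope.

Section Defs.
Variable R : realType.
Variable n : nat.

Definition leb := (@lebesgue_measure R).

Definition laplace (f : R -> R) (p : R) : R :=
  Rintegral leb `]0, +oo[ (fun t => expR (- (p * t)) * f t).

Definition assumption_kk (k : R -> R) : Prop :=
  [/\ (forall t, 0 < t -> 0 <= k t),
      (forall T, 0 < T -> leb.-integrable `]0, T] (EFin \o k)),
      (0%E < leb [set t : R | (0 < t)%R /\ k t != 0%R])%E &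
      (forall p, 0 < p ->
         leb.-integrable `]0, +oo[ (fun t => (expR (- (p * t)) * k t)%:E))].

Definition enorm (x : 'rV[R]_n) : R := Num.sqrt (\sum_(i < n) x ord0 i ^+ 2).

Definition evec (i : 'I_n) : 'rV[R]_n := delta_mx ord0 i.

Definition partial (i : 'I_n) (f : 'rV[R]_n -> R) : 'rV[R]_n -> R :=
  fun x => 'D_(evec i) f x.

Definition C2 (f : 'rV[R]_n -> R) : Prop :=
  [/\ continuous f,
      (forall i x, derivable f x (evec i)),
      (forall i, continuous (partial i f)),
      (forall i j x, derivable (partial i f) x (evec j)) &
      (forall i j, continuous (partial j (partial i f)))].

Definition laplacian (f : 'rV[R]_n -> R) (x : 'rV[R]_n) : R :=
  \sum_(i < n) partial i (partial i f) x.

Definition poly_bounded_LT_solution (k : R -> R) (w0 : 'rV[R]_n -> R)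
    (w : R -> 'rV[R]_n -> R) : Prop :=
  let K := laplace k in
  let tw := fun p x => laplace (fun t => w t x) p in
  [/\ (exists P : {poly R}, forall t x, 0 <= t -> `|w t x| <= P.[enorm x]),
      (forall t0, 0 <= t0 -> forall eps, 0 < eps -> exists2 delta, 0 < delta &
         forall t, 0 <= t -> `|t - t0| < delta ->
           forall x, `|w t x - w t0 x| < eps),
      (forall x, w 0 x = w0 x),
      (forall p, 0 < p -> C2 (tw p)) &
      (forall p x, 0 < p ->
         p * K p * tw p x - K p * w0 x = laplacian (tw p) x)].

End Defs.

(* Main.v *)
(** For each p > 0 the function u = tw p satisfies a u = Laplacian u with
    a = p K(p) > 0, and it is polynomially bounded in x.  Compare u with eps phi,
    where phi x = sum_i (x_i^(2m+2) + b^(m+1)) outgrows u and b is large enough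
    that Laplacian phi <= a phi: at a maximum of u - eps phi one has
    a u <= eps Laplacian phi <= a eps phi, so u <= eps phi everywhere.  Hence
    u = 0, for all p.

    The Laplace transform is injective on bounded continuous functions f: if it
    vanishes, then exp(-t) Q(exp(-t))^m f(t) has integral zero for every
    polynomial Q.  If f t0 > 0, take Q(y) = 1 + a^2 - (y - exp(-t0))^2, which is
    > 1 near t0 and of modulus <= 1 away from it; as m grows the integral near t0
    explodes while the rest stays bounded. *)
Require Import Defs.
From HB Require Import structures.
From mathcomp Require Import all_boot all_order all_algebra.
From mathcomp Require Import all_classical all_reals all_analysis.
From mathcomp Require Import measurable_realfun.
From mathcomp Require Import ring lra.
Set Implicit Arguments.
Unset Strict Implicit.
Unset Printing Implicit Defensive.
Import Order.TTheory GRing.Theory Num.Theory.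
Import numFieldNormedType.Exports.
Local Open Scope classical_set_scope.
Local Open Scope ring_scope.

(** * Existence, size and positivity of Laplace integrals *)

(* The sigma-algebra underlying [leb] is displayed as [measurableTypeR R], which
   does not unify with the display of [measurable_itv]. *)
Lemma measurable_itv_leb (R : realType) (i : interval R) :
  measurable ([set` i] : set (measurableTypeR R)).
Proof. exact: measurable_itv. Qed.

(** The function is [p^-1] times the exponential density. The flag [b] includes or excludes the
    endpoint 0, since the density is integrated over the closed half-line and the transform over the
    open one. *)
Lemma integrable_expRN (R : realType) (p : R) (b : bool) : 0 < p ->
  (@leb R).-integrable [set` Interval (BSide b 0) +oo%O]
    (EFin \o (fun t => expR (- (p * t)))).
Proof.
move=> p0.
have i1 : (@leb R).-integrable [set` Interval (BSide b 0) +oo%O]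
    (EFin \o exponential_pdf p).
  apply: integrableS (integrable_exponential_pdf p0) => //.
have := integrableZl (measurable_itv_leb _) p^-1 i1; apply: eq_integrable => //.
move=> t; rewrite inE/= in_itv/= andbT => t0.
by rewrite exponential_pdfE ?(lteifW t0)// -EFinM mulKf ?gt_eqF// mulNr.
Qed.

Lemma Rintegral_expRN (R : realType) (p : R) : 0 < p ->
  \int[@leb R]_(t in `]0, +oo[) expR (- (p * t)) = p^-1.
Proof.
move=> p0; rewrite Rintegral_itv_obnd_cbnd; last exact: integrable_expRN.
have e1 : \int[@leb R]_(t in `[0, +oo[) (p * expR (- (p * t))) = 1.
  rewrite Rintegral_mkcond /Rintegral.
  rewrite (_ : (fun t => p * _) = fun t => p * expR (- p * t)).
    by rewrite /leb integral_exponential_pdf.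
  by apply/funext => t; rewrite mulNr.
apply: (mulfI (lt0r_neq0 p0)); rewrite divff ?gt_eqF// -[RHS]e1 RintegralZl//.
exact: integrable_expRN.
Qed.

Lemma laplace_integrable (R : realType) (f : R -> R) (M p : R) :
  measurable_fun (`]0, +oo[ : set (measurableTypeR R)) f ->
  (forall t, 0 <= t -> `|f t| <= M) -> 0 < p ->
  (@leb R).-integrable `]0, +oo[ (EFin \o (fun t => expR (- (p * t)) * f t)).
Proof.
move=> mf fM p0.
have M0 : 0 <= M by rewrite (le_trans _ (fM 0 _)).
have := integrableZl (measurable_itv_leb _) M (integrable_expRN false p0).
apply: le_integrable => //.
  apply/measurable_EFinP; apply: measurable_funM => //.
  apply: measurable_funTS; apply: continuous_measurable_fun => t.
  apply: continuous_comp; last exact: continuous_expR.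
  by apply: continuousN; exact: mulrl_continuous.
move=> t /=; rewrite in_itv/= andbT => t0.
rewrite lee_fin !normrM mulrC (ger0_norm M0) ler_wpM2r//.
by rewrite fM // ltW.
Qed.

Lemma laplace_le (R : realType) (f : R -> R) (M p : R) :
  measurable_fun (`]0, +oo[ : set (measurableTypeR R)) f ->
  (forall t, 0 <= t -> `|f t| <= M) -> 0 < p ->
  `|laplace f p| <= M / p.
Proof.
move=> mf fM p0.
have i1 := laplace_integrable mf fM p0; have i2 := integrable_expRN false p0.
apply: (le_trans (le_normr_Rintegral _ i1)) => //.
rewrite -(Rintegral_expRN p0) -RintegralZl//.
apply: le_Rintegral => //.
- exact: (integrable_norm i1).
- exact: (integrableZl (measurable_itv_leb _) M i2).
- move=> t /=; rewrite in_itv/= andbT => t0.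
  rewrite normrM (ger0_norm (expR_ge0 _)) mulrC ler_wpM2r ?expR_ge0 // fM //.
  exact: ltW.
Qed.

(** A nonnegative integrand with zero integral vanishes almost everywhere; as the exponential never
    vanishes, [k] itself would be zero almost everywhere on the half-line. *)
Lemma laplace_gt0 (R : realType) (k : R -> R) (p : R) :
  (forall t, 0 < t -> 0 <= k t) ->
  (0 < @leb R [set t : R | (0 < t)%R /\ k t != 0%R])%E ->
  (@leb R).-integrable `]0, +oo[ (fun t => (expR (- (p * t)) * k t)%:E) ->
  0 < laplace k p.
Proof.
move=> k0 kpos ik; rewrite lt_neqAle; apply/andP; split; last first.
  apply: Rintegral_ge0 => t /=; rewrite in_itv/= andbT => t0.
  by rewrite mulr_ge0 ?expR_ge0 ?k0.
apply/eqP => L0.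
have : (\int[@leb R]_(t in `]0%R, +oo[) `|(expR (- (p * t)) * k t)%:E| = 0)%E.
  transitivity (\int[@leb R]_(t in `]0%R, +oo[) (expR (- (p * t)) * k t)%:E)%E.
    apply: eq_integral => t; rewrite inE/= in_itv/= andbT => t0.
    by rewrite ger0_norm// mulr_ge0 ?expR_ge0 ?k0.
  have := fineK (integrable_fin_num (measurable_itv_leb _) ik).
  by rewrite /laplace/Rintegral/= in L0; rewrite -L0 => <-.
move/(ae_eq_integral_abs _ (measurable_itv_leb _) (measurable_int _ ik)).
move=> [N [mN N0 sN]].
suff : (@leb R [set t : R | (0 < t)%R /\ k t != 0%R] <= @leb R N)%E.
  by rewrite [X in (_ <= X)%E -> _]N0 leNgt kpos.
(* Monotonicity of the outer measure spares a measurability proof for the set where [k] is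
   nonzero. *)
apply: le_outer_measure => t /= [t0 kt].
apply: sN => /= /(_ _)/wrap[]; first by rewrite /= in_itv/= t0.
by move=> /eqP; rewrite eqe mulf_eq0 (negbTE kt) gt_eqF ?expR_gt0.
Qed.

(** * Injectivity of the Laplace transform on bounded continuous functions *)

Lemma integrable_addR (R : realType) (i : interval R) (f g : R -> R) :
  (@leb R).-integrable [set` i] (EFin \o f) ->
  (@leb R).-integrable [set` i] (EFin \o g) ->
  (@leb R).-integrable [set` i] (EFin \o (fun t => f t + g t)).
Proof.
by move=> if_ ig; apply: eq_integrable (integrableD (measurable_itv_leb i) if_ ig) => //.
Qed.

Lemma integrable_mulRl (R : realType) (i : interval R) (c : R) (f : R -> R) :
  (@leb R).-integrable [set` i] (EFin \o f) ->
  (@leb R).-integrable [set` i] (EFin \o (fun t => c * f t)).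
Proof.
by move=> if_; apply: eq_integrable (integrableZl (measurable_itv_leb i) c if_) => //.
Qed.

Lemma measurable_within_continuous (R : realType) (f : R -> R) :
  {within `[0, +oo[, continuous f} ->
  measurable_fun (`]0, +oo[ : set (measurableTypeR R)) f.
Proof.
move=> cf; apply: (@subspace_continuous_measurable_fun R `]0, +oo[ f) => //.
by apply: (continuous_subspaceW _ cf) => t /=; rewrite !in_itv/= !andbT => /ltW.
Qed.

(** Induction along Horner's scheme: a factor ['X] raises [j] by one, and the constant term
    contributes a multiple of the transform at [j.+1], which is zero. The successor keeps the
    transform parameter positive. *)
Lemma laplace_horner_expRN (R : realType) (f : R -> R) (M : R) (q : {poly R})
    (j : nat) :
  measurable_fun (`]0, +oo[ : set (measurableTypeR R)) f ->
  (forall t, 0 <= t -> `|f t| <= M) ->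
  (forall p, 0 < p -> laplace f p = 0) ->
  let g := fun t => expR (- (j.+1%:R * t)) * q.[expR (- t)] * f t in
  (@leb R).-integrable `]0, +oo[ (EFin \o g) /\
  \int[@leb R]_(t in `]0, +oo[) g t = 0.
Proof.
move=> mf fM lf0; elim/poly_ind: q j => [|q c IH] j /=.
  have -> : (fun t => expR (- (j.+1%:R * t)) * (0 : {poly R}).[expR (- t)] * f t)
      = cst 0.
    by apply/funext => t; rewrite horner0 mulr0 mul0r.
  split; first exact: integrable0.
  by rewrite Rintegral_cst ?mul0r//; exact: measurable_itv_leb.
have [i1 e1] := IH j.+1.
have i2 := laplace_integrable mf fM (ltr0Sn R j).
have i3 := integrable_mulRl c i2.
have -> : (fun t => expR (- (j.+1%:R * t)) * (q * 'X + c%:P).[expR (- t)] * f t) =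
    fun t => expR (- (j.+2%:R * t)) * q.[expR (- t)] * f t +
      c * (expR (- (j.+1%:R * t)) * f t).
  apply/funext => t; rewrite hornerMXaddC -(natr1 j.+1) mulrDl mul1r opprD expRD.
  by ring.
split; first exact: integrable_addR i1 i3.
rewrite (RintegralD (measurable_itv_leb _) i1 i3).
rewrite e1 add0r RintegralZl; [|exact: measurable_itv_leb|exact: i2].
by rewrite [X in c * X]lf0 ?mulr0.
Qed.

Lemma laplace_eq0_le0 (R : realType) (f : R -> R) (M : R) :
  {within `[0, +oo[, continuous f} -> (forall t, 0 <= t -> `|f t| <= M) ->
  (forall p, 0 < p -> laplace f p = 0) -> forall t, 0 <= t -> f t <= 0.
Proof.
move=> cf fM lf0 t0 t00; rewrite leNgt; apply/negP => ft0.
have mf := measurable_within_continuous cf.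
have [d d0 fd] : exists2 d, 0 < d &
    forall t, 0 <= t -> `|t - t0| < d -> f t0 / 2 <= f t.
  move/subspace_continuousP : cf => /(_ t0); rewrite /= in_itv/= andbT.
  move=> /(_ t00)/cvgrPdist_lt/(_ (f t0 / 2)); rewrite divr_gt0// => /(_ isT).
  move=> [d/= d0 fd]; exists d => // t t0' tt0.
  have := fd t; rewrite /= distrC tt0 in_itv/= t0' => /(_ isT isT).
  rewrite /from_subspace ltr_norml => /andP[_].
  by lra.
(* In the variable y = exp(-t), [a] and [b] are the distances from [y0] to the images of t0 + d and
   t0 + d/2. *)
set y0 := expR (- t0); set a := y0 * (1 - expR (- d)).
set b := y0 * (1 - expR (- (d / 2))).
have y00 : 0 < y0 by exact: expR_gt0.
have y01 : y0 <= 1 by rewrite -expR0 ler_expR oppr_le0.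
have ed0 : 0 < expR (- d) by exact: expR_gt0.
have ed2 : expR (- d) = expR (- (d / 2)) ^+ 2.
  by rewrite expr2 -expRD; congr expR; lra.
have ed20 : 0 < expR (- (d / 2)) by exact: expR_gt0.
have ed21 : expR (- (d / 2)) < 1 by rewrite expR_lt1; lra.
have b0 : 0 < b by rewrite mulr_gt0// subr_gt0.
have ab : b < a.
  rewrite /a /b ltr_pM2l// ed2 ltrD2l ltrN2 expr2.
  by rewrite -[ltRHS]mulr1 ltr_pM2l.
have ed1 : expR (- d) < 1 by rewrite expR_lt1; lra.
have a1 : a <= 1 by apply: mulr_ile1 => //; lra.
(* For t between t0 and t0 + d/2 one has |y - y0| <= b, hence Q(y) >= 1 + kap. *)
set kap := a ^+ 2 - b ^+ 2.
have kap0 : 0 < kap by rewrite subr_gt0 ltr_pXn2r// nnegrE ltW// (lt_trans b0).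
pose Q : {poly R} := (1 + a ^+ 2)%:P - ('X - y0%:P) ^+ 2.
have QE y : Q.[y] = 1 + a ^+ 2 - (y - y0) ^+ 2 by rewrite /Q !hornerE.
have M0 : 0 <= M by rewrite (le_trans _ (fM 0 _)).
(* A lower bound for exp(-t) f(t) on that interval. *)
set C := expR (- (t0 + d)) * (f t0 / 2).
have C0 : 0 < C by rewrite mulr_gt0 ?expR_gt0// divr_gt0.
(* [M exp(-t)] absorbs the part away from [t0], where [|Q| <= 1]. *)
have key m t : 0 < t ->
    C * (1 + kap) ^+ m * \1_(`]t0, t0 + d / 2[) t <=
    expR (- (1 * t)) * (Q ^+ m).[expR (- t)] * f t + M * expR (- (1 * t)).
  move=> tp; rewrite mul1r horner_exp QE indicE.
  set y := expR (- t).
  have yp : 0 < y by exact: expR_gt0.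
  have y1 : y < 1 by rewrite expR_lt1 oppr_lt0.
  have fMt : `|f t| <= M by rewrite fM// ltW.
  have yy0 : (y - y0) ^+ 2 <= 1 by nra.
  have [td|td] := ltP `|t - t0| d; last first.
    have -> : (t \in (`]t0, t0 + d / 2[%classic : set R)) = false.
      apply/negP; rewrite inE/= in_itv/= => /andP[t1 t2].
      by move: td; rewrite ger0_norm; lra.
    rewrite mulr0.
    (* To the right of [t0], y0 - y >= a is immediate; to the left, y - y0 >= y (1 - exp(-d)) >= a
       because y >= y0. *)
    have ay : a ^+ 2 <= (y - y0) ^+ 2.
      have [tt0|tt0] := leP t0 t.
        have : y <= y0 * expR (- d).
          by rewrite -expRD ler_expR; move: td; rewrite ger0_norm ?subr_ge0//; lra.
        have y0y : 0 <= a by rewrite ltW// (lt_trans b0).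
        by rewrite /a in y0y * => yle; nra.
      have : y0 <= y * expR (- d).
        by rewrite -expRD ler_expR; move: td; rewrite ltr0_norm ?subr_lt0//; lra.
      have y0y : 0 <= a by rewrite ltW// (lt_trans b0).
      have yy : y0 <= y by rewrite ler_expR; lra.
      move=> yle.
      have ale : a <= y - y0 by rewrite /a; nra.
      by nra.
    have Q1 : `|1 + a ^+ 2 - (y - y0) ^+ 2| <= 1.
      by rewrite ler_norml; apply/andP; split; nra.
    have : `|y * (1 + a ^+ 2 - (y - y0) ^+ 2) ^+ m * f t| <= M * y.
      rewrite !normrM normrX (gtr0_norm yp) -mulrA mulrC ler_pM2r//.
      by rewrite -[leRHS]mul1r ler_pM ?exprn_ile1.
    by rewrite ler_norml => /andP[+ _]; lra.
  have ft := fd t (ltW tp) td.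
  have a2 : 0 < a ^+ 2 by rewrite exprn_gt0// (lt_trans b0).
  (* Within distance [d] of [t0] but off the interval, [Q] and [f] are both nonnegative, so the left
     side 0 is no obstacle. *)
  have [/set_mem/=|tJ] := boolP (t \in (`]t0, t0 + d / 2[%classic : set R)); last first.
    rewrite mulr0 addr_ge0//; last by rewrite mulr_ge0// ltW.
    by rewrite !mulr_ge0// ?exprn_ge0//; [exact: ltW|lra|lra].
  rewrite in_itv/= => /andP[t1 t2]; rewrite mulr1.
  rewrite -[leLHS]addr0 lerD//; last by rewrite mulr_ge0// ltW.
  rewrite /C mulrAC; apply: ler_pM; rewrite ?ft//.
  - by rewrite mulr_ge0 ?expR_ge0 ?exprn_ge0//; lra.
  - by rewrite divr_ge0// ltW.
  apply: ler_pM; rewrite ?expR_ge0 ?exprn_ge0//; [lra|by rewrite ler_expR; lra|].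
  have yle : y <= y0 by rewrite ler_expR; lra.
  have yge : y0 * expR (- (d / 2)) <= y by rewrite -expRD ler_expR; lra.
  have yb : (y - y0) ^+ 2 <= b ^+ 2.
    have : y0 - y <= b by rewrite /b; lra.
    by move: yle b0; nra.
  by apply: lerXn2r; rewrite ?nnegrE; move: kap0; rewrite /kap; lra.
(* Integrate [key]: the polynomial term contributes 0 and the exponential one contributes [M]. *)
have bound m : C * (1 + kap) ^+ m * (d / 2) <= M.
  have /= [i1 e1] := laplace_horner_expRN (Q ^+ m) 0 mf fM lf0.
  have i2 := integrable_mulRl M (integrable_expRN false (@ltr01 R)).
  have i3 := integrable_addR i1 i2.
  have i4 : (@leb R).-integrable `]0, +oo[
      (EFin \o (\1_(`]t0, t0 + d / 2[) : R -> R)).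
    apply: integrableS (integrable_indic_itv _ _ _ _) => //.
  have i5 := integrable_mulRl (C * (1 + kap) ^+ m) i4.
  have : \int[@leb R]_(t in `]0, +oo[) \1_(`]t0, t0 + d / 2[) t = d / 2.
    rewrite /Rintegral integral_indic//; try exact: measurable_itv_leb.
    rewrite setIidl; last first.
      by move=> t /=; rewrite !in_itv/= andbT => /andP[/(le_lt_trans t00)].
    transitivity (fine (lebesgue_measure (`]t0, t0 + d / 2[%classic : set R))) => //.
    rewrite lebesgue_measure_itv/= lte_fin ltrDl divr_gt0//.
    by rewrite -EFinB/= addrC addKr.
  move=> eJ; rewrite -eJ -(RintegralZl _ (measurable_itv_leb _) i4).
  have eM : \int[@leb R]_(t in `]0, +oo[)
      (expR (- (1 * t)) * (Q ^+ m).[expR (- t)] * f t +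
        M * expR (- (1 * t))) = M.
    rewrite (RintegralD (measurable_itv_leb _) i1 i2).
    rewrite e1 add0r (RintegralZl _ (measurable_itv_leb _)); last exact: integrable_expRN.
    by rewrite Rintegral_expRN// invr1 mulr1.
  rewrite -[leRHS]eM; apply: (le_Rintegral (measurable_itv_leb _) i5 i3).
  by move=> t /=; rewrite in_itv/= andbT; exact: key.
have [m mM] : exists m : nat, M / (C * (d / 2) * kap) < m%:R.
  by exists (Num.truncn (M / (C * (d / 2) * kap))).+1; rewrite truncnS_gt.
(* Bernoulli's inequality makes the left side of [bound] exceed [M] for the chosen [m]. *)
have bern : 1 + m%:R * kap <= (1 + kap) ^+ m.
  elim: m {mM} => [|m IHm]; first by rewrite mul0r addr0.
  rewrite exprS -natr1; have : 0 <= m%:R :> R by [].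
  by nra.
have Cd : 0 < C * (d / 2) by rewrite mulr_gt0// divr_gt0.
move: mM; rewrite ltr_pdivrMr ?(mulr_gt0 Cd)// => mM.
by have := bound m; rewrite mulrAC; nra.
Qed.

Lemma laplace_eq0 (R : realType) (f : R -> R) (M : R) :
  {within `[0, +oo[, continuous f} -> (forall t, 0 <= t -> `|f t| <= M) ->
  (forall p, 0 < p -> laplace f p = 0) -> forall t, 0 <= t -> f t = 0.
Proof.
move=> cf fM lf0 t t0; apply/eqP; rewrite eq_le (laplace_eq0_le0 cf fM)//=.
rewrite -oppr_le0.
apply: (@laplace_eq0_le0 R (fun t => - f t) M) => //.
- by move=> x; apply: continuousN; exact: cf.
- by move=> s s0; rewrite normrN fM.
- move=> p p0; rewrite /laplace.
  under eq_Rintegral do rewrite mulrN -mulN1r.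
  have mf := measurable_within_continuous cf.
  rewrite RintegralZl; last exact: (laplace_integrable mf fM p0).
    by rewrite [X in _ * X]lf0 ?mulr0.
  exact: measurable_itv_leb.
Qed.

(** * Second derivative test along lines *)

(** Here g'(0) = 0, so l > 0 would make g' positive just to the right of 0, and the mean value
    theorem would give g(e/2) > g(0). *)
Lemma deriv2_le0_at_max (R : realType) (g dg : R -> R) (l : R) :
  (forall s : R, is_derive s 1 g (dg s)) -> is_derive (0 : R) 1 dg l ->
  (forall s, g s <= g 0) -> l <= 0.
Proof.
move=> Dg Ddg gmax; rewrite leNgt; apply/negP => l0.
have dg0 : dg 0 = 0.
  have D0 : is_derive (0 : R) 1 g 0.
    apply: (@derive1_at_max R g (-1) 1 0) => [|t _||t _].
        by rewrite (le_trans (lerN10 _)).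
      exact: ex_derive.
    by rewrite in_itv/= ltrN10 ltr01.
    exact: gmax.
  by rewrite -(@derive_val _ _ _ _ _ _ _ (Dg 0)) (@derive_val _ _ _ _ _ _ _ D0).
have cv : h^-1 *: (dg (h *: 1 + 0) - dg 0) @[h --> 0^'] --> l.
  have := @ex_derive _ _ _ _ _ _ _ Ddg.
  move=> /cvg_ex[l' cl'].
  by rewrite -(@derive_val _ _ _ _ _ _ _ Ddg) /derive (cvg_lim _ cl').
move/cvgrPdist_lt : cv => /(_ l l0)[e/= e0 He].
have dgpos s : 0 < s -> s < e -> 0 < dg s.
  move=> s0 se; have := He s.
  rewrite /= sub0r normrN gtr0_norm// => /(_ se (lt0r_neq0 s0)).
  rewrite dg0 subr0 addr0 -[s *: 1]/(s * 1) mulr1 -[_ *: _]/(_ * _).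
  rewrite ltr_norml => /andP[_ h].
  have : 0 < s^-1 * dg s by lra.
  by rewrite pmulr_rgt0// invr_gt0.
have cg : {within `[0, e / 2], continuous g}.
  apply: continuous_subspaceT => x.
  by apply: differentiable_continuous; apply/derivable1_diffP; exact: ex_derive.
have [c] := MVT (divr_gt0 e0 (ltr0Sn _ 1)) (fun x _ => Dg x) cg.
rewrite in_itv/= => /andP[c0 ce].
have : 0 < dg c by apply: dgpos => //; lra.
have := gmax (e / 2); rewrite subr0 => g1 g2 g3.
have : 0 < dg c * (e / 2) by rewrite mulr_gt0// divr_gt0.
by lra.
Qed.

(** Turns directional derivatives into one-variable ones: both difference quotients are the same
    function of h. *)
Lemma is_derive_line (R : realType) (V : normedModType R) (f : V -> R) (x v : V)
    (s : R) :
  derivable f (s *: v + x) v ->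
  is_derive s 1 (fun h : R => f (h *: v + x)) ('D_v f (s *: v + x)).
Proof.
move=> df.
have E : (fun h : R => h^-1 *: (((fun h : R => f (h *: v + x)) \o shift s) (h *: 1)
    - f (s *: v + x))) =
  (fun h : R => h^-1 *: ((f \o shift (s *: v + x)) (h *: v) - f (s *: v + x))).
  apply/funext => h /=; rewrite -[h *: 1]/(h * 1) mulr1 scalerDl -addrA.
  by [].
by apply: DeriveDef; rewrite /derivable /derive E.
Qed.

(** * Polynomial growth and the barrier function *)

(** The base 1 + r is at least 1, so every lower power is dominated by the [m]-th. *)
Lemma norm_horner_le (R : realType) (Q : {poly R}) (m : nat) (r : R) :
  0 <= r -> (size Q <= m)%N ->
  `|Q.[r]| <= (\sum_(i < size Q) `|Q`_i|) * (1 + r) ^+ m.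
Proof.
move=> r0 sQ; rewrite horner_coef mulr_suml.
apply: (le_trans (ler_norm_sum _ _ _)); apply: ler_sum => i _.
rewrite normrM ler_wpM2l// normrX ger0_norm//.
apply: (@le_trans _ _ ((1 + r) ^+ i)); first by apply: lerXn2r; rewrite ?nnegrE; lra.
by apply: ler_weXn2l; [lra | rewrite (leq_trans _ sQ)// ltnW].
Qed.

Lemma normr_coord_le (R : realType) (n : nat) (x : 'rV[R]_n) (i : 'I_n) :
  `|x ord0 i| <= `|x|.
Proof.
rewrite [leRHS]/Num.norm/= mx_normrE.
exact: (@le_bigmax _ R _ 0 (fun ij => `|x ij.1 ij.2|) (ord0, i)).
Qed.

(** The norm on row vectors is the sup norm; the crude factor n, in place of its square root,
    suffices for growth estimates. *)
Lemma enorm_le (R : realType) (n : nat) (x : 'rV[R]_n) : enorm x <= n%:R * `|x|.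
Proof.
have nx : 0 <= n%:R * `|x| by rewrite mulr_ge0.
rewrite -(ger0_norm nx) -sqrtr_sqr; apply: ler_wsqrtr.
apply: (@le_trans _ _ (\sum_(i < n) `|x| ^+ 2)).
  apply: ler_sum => i _; rewrite -[x _ _ ^+ 2]real_normK ?num_real//.
  by apply: lerXn2r; rewrite ?nnegrE ?normr_coord_le.
rewrite sumr_const card_ord -[leLHS]mulr_natl exprMn ler_wpM2r ?sqr_ge0//.
by rewrite -natrX ler_nat; case: n {x nx} => // n; rewrite expnS leq_pmulr.
Qed.

Lemma normr_coord_ex (R : realType) (n : nat) (x : 'rV[R]_n) :
  0 < `|x| -> exists i, `|x| = `|x ord0 i|.
Proof.
move=> x0; have [|[k i] /= xi] := @mx_norm_neq0 _ _ _ x; first exact: lt0r_neq0.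
by exists i; move: xi; rewrite (ord1 k).
Qed.

Lemma mulr_exprn_le (R : realType) (b t : R) (m : nat) : 0 <= b -> 0 <= t ->
  b * t ^+ m <= t ^+ m.+1 + b ^+ m.+1.
Proof.
move=> b0 t0; have [bt|tb] := leP b t.
  by rewrite -[leLHS]addr0 exprS lerD ?exprn_ge0// ler_wpM2r ?exprn_ge0.
rewrite -[leLHS]add0r (exprS b); apply: lerD; first exact: exprn_ge0.
by apply: ler_wpM2l => //; apply: lerXn2r; rewrite ?nnegrE// ltW.
Qed.

Lemma barrier_term_ge0 (R : realType) (m : nat) (b y : R) : 0 <= b ->
  0 <= (y ^+ 2) ^+ m.+1 + b ^+ m.+1.
Proof. by move=> b0; rewrite addr_ge0// exprn_ge0// sqr_ge0. Qed.

(* The constant [b ^+ m.+1] makes [laplacian (barrier m b) <= a * barrier m b]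
   when [a * b = (2m+2)(2m+1)], by [mulr_exprn_le]. *)
Definition barrier (R : realType) (n m : nat) (b : R) (x : 'rV[R]_n) : R :=
  \sum_(i < n) ((x ord0 i ^+ 2) ^+ m.+1 + b ^+ m.+1).

Lemma barrier_ge0 (R : realType) (n m : nat) (b : R) (x : 'rV[R]_n) : 0 <= b ->
  0 <= barrier m b x.
Proof.
by move=> b0; apply: sumr_ge0 => i _; exact: barrier_term_ge0.
Qed.

(** One coordinate attains the sup norm, and its summand alone gives the bound. *)
Lemma barrier_ge (R : realType) (n m : nat) (b : R) (x : 'rV[R]_n) : 0 <= b ->
  0 < `|x| -> (`|x| ^+ 2) ^+ m.+1 <= barrier m b x.
Proof.
move=> b0 /normr_coord_ex[i xi]; rewrite /barrier (bigD1 i)//=.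
rewrite xi real_normK ?num_real// -addrA lerDl addr_ge0//; first exact: exprn_ge0.
by apply: sumr_ge0 => j _; exact: barrier_term_ge0.
Qed.

Lemma barrier_continuous (R : realType) (n m : nat) (b : R) :
  continuous (@barrier R n m b).
Proof.
move=> x; apply: (@continuous_big R _ +%R 0 xpredT (@add_continuous _)) => i _ {}x.
apply: (@continuous_comp _ _ _ (fun x : 'rV[R]_n => x ord0 i)
  (fun y : R => (y ^+ 2) ^+ m.+1 + b ^+ m.+1)); first exact: coord_continuous.
apply: cvgD; last exact: cvg_cst.
by apply: (@continuous_comp _ _ _ (fun z : R => z ^+ 2) (fun z => z ^+ m.+1));
  exact: exprn_continuous.
Qed.

Lemma barrier_line (R : realType) (n m : nat) (b s : R) (x : 'rV[R]_n) (i : 'I_n) :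
  barrier m b (s *: evec R i + x) =
  ((s + x ord0 i) ^+ 2) ^+ m.+1 - (x ord0 i ^+ 2) ^+ m.+1 + barrier m b x.
Proof.
rewrite /barrier (bigD1 i)//= [in RHS](bigD1 i)//= !mxE !eqxx mulr1 !addrA subrK.
congr (_ + _); apply: eq_bigr => j ji.
by rewrite !mxE eqxx (negbTE ji) mulr0 add0r.
Qed.

Lemma is_derive_shiftX (R : realType) (c s : R) (k : nat) :
  is_derive s 1 (fun t : R => (t + c) ^+ k) (k%:R * (s + c) ^+ k.-1).
Proof.
have d1 : is_derive s 1 (fun t : R => t + c) 1.
  rewrite -[X in is_derive _ _ _ X]addr0.
  exact: (@is_deriveD _ _ _ (id : R -> R) (cst c) s 1 1 0).
have := is_deriveX k d1; rewrite -[_ *: _]/(_ * _) mulr1.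
by rewrite exprfctE.
Qed.

(** Along the [i]-th coordinate line only one summand of the barrier varies, so the second
    derivative test applies to the restriction. *)
Lemma partial2_le_at_max (R : realType) (n m : nat) (b eps : R)
    (u : 'rV[R]_n -> R) (x : 'rV[R]_n) (i : 'I_n) :
  C2 u ->
  (forall z, u z - eps * barrier m b z <= u x - eps * barrier m b x) ->
  partial i (partial i u) x <=
  eps * (m.*2.+2%:R * m.*2.+1%:R * (x ord0 i ^+ 2) ^+ m).
Proof.
case=> _ du _ ddu _ xmax; rewrite -subr_le0.
set e := evec R i; set c := x ord0 i; set k := m.*2.+2.
(* This is the restriction of u - eps barrier up to an additive constant. *)
pose g s := u (s *: e + x) - eps * (s + c) ^+ k.
pose dg s := partial i u (s *: e + x) - eps * (k%:R * (s + c) ^+ k.-1).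
apply: (@deriv2_le0_at_max R g dg).
- move=> s; apply: is_deriveB; first exact: is_derive_line (du i _).
  exact: is_deriveZ (is_derive_shiftX _ _ _).
- have -> : partial i (partial i u) x -
      eps * (k%:R * m.*2.+1%:R * (c ^+ 2) ^+ m) =
      'D_e (partial i u) (0 *: e + x) -
      eps * (k%:R * (m.*2.+1%:R * (0 + c) ^+ m.*2)).
    by rewrite scale0r !add0r -exprM mul2n -mulrA.
  apply: is_deriveB; first exact: is_derive_line (ddu i i _).
  apply: is_deriveZ; apply: is_deriveZ; exact: is_derive_shiftX.
- move=> s; have := xmax (s *: e + x).
  rewrite barrier_line /g scale0r !add0r -!exprM mul2n doubleS -/k -/c.
  by lra.
Qed.

(** * Liouville theorem by comparison with the barrier *)

Lemma liouville_le0 (R : realType) (n : nat) (a : R) (P : {poly R})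
    (u : 'rV[R]_n -> R) :
  0 < a -> C2 u -> (forall x, u x <= P.[enorm x]) ->
  (forall x, a * u x = laplacian u x) -> forall x, u x <= 0.
Proof.
move=> a0 C2u uP ulap x.
(* [P] grows at most like the power [m], strictly below the barrier's degree 2m + 2. *)
set m := size P.
have [b b0 ab] : exists2 b, 0 <= b & a * b = m.*2.+2%:R * m.*2.+1%:R.
  exists (m.*2.+2%:R * m.*2.+1%:R / a); first by rewrite divr_ge0 ?mulr_ge0// ltW.
  by rewrite mulrC divfK// gt_eqF.
(* If u x > 0, taking eps = u x / (1 + barrier) yields a contradiction; the added 1 keeps the
   denominator positive. *)
suff ub eps z : 0 < eps -> u z <= eps * barrier m b z.
  have Bx := barrier_ge0 m x b0.
  rewrite leNgt; apply/negP => ux.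
  have B1 : 0 < 1 + barrier m b x by lra.
  have := ub _ x (divr_gt0 ux B1).
  rewrite mulrAC ler_pdivlMr// ler_pM2l//; lra.
move=> eps0; rewrite leNgt; apply/negP => uz.
pose v z := u z - eps * barrier m b z.
have cv : continuous v.
  move=> y; case: C2u => cu _ _ _ _.
  apply: (@continuousB _ _ _ u (fun z => eps * barrier m b z)); first exact: cu.
  apply: (@continuousM _ _ (cst eps) (barrier m b)); first exact: cst_continuous.
  exact: barrier_continuous.
set S := \sum_(i < size P) `|P`_i|.
have S0 : 0 <= S by apply: sumr_ge0.
(* The three terms serve in turn to make |y| >= 1 outside the ball, to put [z] inside it, and to
   absorb the coefficients of [P] into eps |y|. *)
pose r := 1 + `|z| + S * (1 + n%:R) ^+ m / eps.
have Sn0 : 0 <= S * (1 + n%:R) ^+ m / eps.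
  by rewrite divr_ge0 ?mulr_ge0 ?exprn_ge0 ?addr_ge0// ltW.
have out y : r < `|y| -> v y <= 0.
  move=> ry; set N := `|y| in ry *.
  have N1 : 1 <= N by move: (normr_ge0 z); rewrite /r in ry; lra.
  have NS : S * (1 + n%:R) ^+ m <= eps * N.
    rewrite -ler_pdivrMl// mulrC; move: (normr_ge0 z); rewrite /r in ry; lra.
  have yN : 1 + enorm y <= (1 + n%:R) * N.
    by have := enorm_le y; rewrite -/N; lra.
  have e0 : 0 <= enorm y by exact: sqrtr_ge0.
  rewrite /v subr_le0; apply: (le_trans (uP y)).
  apply: (le_trans (ler_norm _)); apply: (le_trans (norm_horner_le e0 (leqnn _))).
  rewrite -/m -/S.
  apply: (@le_trans _ _ (S * ((1 + n%:R) * N) ^+ m)).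
    by rewrite ler_wpM2l// lerXn2r// nnegrE; [lra|rewrite mulr_ge0//; lra].
  rewrite exprMn mulrA; apply: (@le_trans _ _ (eps * N * N ^+ m)).
    by rewrite ler_wpM2r// exprn_ge0//; lra.
  rewrite -mulrA -exprS ler_pM2l//.
  have N0 : 0 < `|y| by rewrite -/N; lra.
  apply: le_trans (barrier_ge m b0 N0).
  by rewrite -/N -exprM ler_weXn2l// mul2n -addnn leq_addr.
have [x0 x0r x0max] : exists2 c : 'rV[R]_n, c \in [set y : 'rV[R]_n | `|y| <= r] &
    forall t, t \in [set y : 'rV[R]_n | `|y| <= r] -> v t <= v c.
  apply: EVT_max_rV.
  - by exists z => /=; rewrite /r; lra.
  - apply: bounded_closed_compact.
      exists r; split; first exact: num_real.
      by move=> M rM y /= yr; rewrite (le_trans yr)// ltW.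
    apply: (@preimage_closed _ _ (fun y : 'rV[R]_n => `|y|) [set t | t <= r]) => //.
    by move=> y _; exact: norm_continuous.
  - by apply: continuous_subspaceT.
have vx0 : 0 < v x0.
  apply: (@lt_le_trans _ _ (v z)); first by rewrite subr_gt0.
  by apply: x0max; rewrite inE/= /r; lra.
(* The maximum over the ball is global, since [v] is at most 0 outside and positive at [x0]. *)
have vmax y : v y <= v x0.
  have [yr|yr] := leP `|y| r; first by apply: x0max; rewrite inE.
  by rewrite (le_trans (out _ yr))// ltW.
(* Sum the second derivative bounds over the coordinates; the choice of a b and [mulr_exprn_le]
   compare each term with its barrier summand. *)
have : a * u x0 <= a * (eps * barrier m b x0).
  rewrite ulap /laplacian /barrier !mulr_sumr; apply: ler_sum => i _.
  apply: (le_trans (partial2_le_at_max i C2u vmax)).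
  rewrite -ab -!mulrA (mulrCA a eps) ler_pM2l// ler_pM2l//.
  by rewrite mulr_exprn_le// sqr_ge0.
by rewrite ler_pM2l// leNgt -subr_gt0 vx0.
Qed.

Lemma partialN (R : realType) (n : nat) (i : 'I_n) (u : 'rV[R]_n -> R) :
  (forall x, derivable u x (evec R i)) ->
  partial i (fun x => - u x) = fun x => - partial i u x.
Proof. by move=> du; apply/funext => x; exact: deriveN. Qed.

Lemma C2N (R : realType) (n : nat) (u : 'rV[R]_n -> R) :
  C2 u -> C2 (fun x => - u x).
Proof.
case=> cu du cdu ddu cddu.
have pN i := partialN (du i).
split.
- by move=> x; apply: continuousN; exact: cu.
- by move=> i x; exact: derivableN.
- by move=> i x; rewrite pN; apply: continuousN; exact: cdu.
- by move=> i j x; rewrite pN; exact: derivableN.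
- move=> i j x; rewrite pN (partialN (ddu i j)).
  by apply: continuousN; exact: cddu.
Qed.

Lemma laplacianN (R : realType) (n : nat) (u : 'rV[R]_n -> R) (x : 'rV[R]_n) :
  C2 u -> laplacian (fun x => - u x) x = - laplacian u x.
Proof.
case=> _ du _ ddu _; rewrite /laplacian -sumrN; apply: eq_bigr => i _.
by rewrite (partialN (du i)) (partialN (ddu i i)).
Qed.

Lemma liouville (R : realType) (n : nat) (a : R) (P : {poly R})
    (u : 'rV[R]_n -> R) :
  0 < a -> C2 u -> (forall x, `|u x| <= P.[enorm x]) ->
  (forall x, a * u x = laplacian u x) -> forall x, u x = 0.
Proof.
move=> a0 C2u uP ulap x; apply/eqP; rewrite eq_le; apply/andP; split.
  apply: (liouville_le0 a0 C2u _ ulap) => y.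
  by rewrite (le_trans (ler_norm _)).
rewrite -oppr_le0; apply: (liouville_le0 a0 (C2N C2u)) => y.
  by rewrite (le_trans (ler_norm _))// normrN.
by rewrite laplacianN// -ulap mulrN.
Qed.

(** * Uniqueness for the Cauchy problem *)

Theorem theorem4 (R : realType) (n : nat) (k : R -> R)
    (w : R -> 'rV[R]_n -> R) :
  assumption_kk k ->
  poly_bounded_LT_solution k (fun _ => 0) w ->
  forall t x, 0 <= t -> w t x = 0.
Proof.
move=> [k0 _ kpos kint] [[P wP] wcont _ C2w eqw] t x t0.
have cw y : {within `[0, +oo[, continuous (fun s => w s y)}.
  apply/subspace_continuousP => s /=; rewrite in_itv/= andbT => s0.
  apply/cvgrPdist_lt => e e0; have [d d0 wd] := wcont s s0 e e0.
  exists d => //= s' ss'; rewrite in_itv/= andbT => s'0.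
  by rewrite distrC; apply: wd; rewrite // distrC.
have wM y s : 0 <= s -> `|w s y| <= P.[enorm y] by exact: wP.
apply: (laplace_eq0 (cw x) (wM x)) => // p p0.
(* The factor [p^-1] is the integral of exp(-pt), by which the transform inherits the bound [P]. *)
apply: (@liouville R n (p * laplace k p) (p^-1 *: P)
  (fun y => laplace (w^~ y) p)) => //.
- by rewrite mulr_gt0// laplace_gt0// kint.
- exact: C2w.
- move=> y; rewrite hornerZ mulrC.
  exact: laplace_le (measurable_within_continuous (cw y)) (wM y) p0.
- by move=> y; rewrite -eqw// mulr0 subr0.
Qed.
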